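(* Let $n\ge 1$ and let $\alpha=(\alpha_1,\dots,\alpha_\ell)$ be a composition of $n$, with partial sums $s_j=\alpha_1+\dots+\alpha_j$ for $1\le j\le \ell$. Let $N(\alpha)$ denote the number of alternating permutations $w$ of $[2n]$ whose record composition $\operatorname{rc}(\hat w)$ equals $\alpha$, i.e. $N(\alpha):=\#\{w\in\mathcal{A}_{2n} : \operatorname{rc}(\hat w)=\alpha\}$. Then $$N(\alpha)=\prod_{j=1}^{\ell}\binom{2s_j-1}{2\alpha_j-1}\,E_{2\alpha_j-1}.$$
   Context: $[m]=\{1,\dots,m\}$. A composition of $n$ is a finite sequence of positive integers with sum $n$. A permutation $w=a_1a_2\dots a_m$ of $[m]$ in one-line notation is alternating if $a_1>a_2<a_3>a_4<\cdots$, that is, $a_i>a_{i+1}$ for odd $i$ and $a_i<a_{i+1}$ for even $i$ ($1\le i\le m-1$). $\mathcal{A}_{2n}$ is the set of alternating permutations of $[2n]$. The Euler number $E_k$ is the number of alternating permutations of $[k]$, with $E_0=1$; equivalently $\sec t+\tan t=\sum_{k\ge 0}E_k t^k/k!$. For $w=a_1a_2\dots a_{2n}\in\mathcal{A}_{2n}$, let $\hat w=b_1b_2\dots b_n$ with $b_i=a_{2i-1}$. An index $i\in[n]$ is a record position of $\hat w$ if $b_i>b_j$ for all $1\le j<i$ (so $1$ is always a record position). If $r_1=1<r_2<\dots<r_\ell$ are all the record positions of $\hat w$ and $r_{\ell+1}:=n+1$, the record composition of $\hat w$ is $\operatorname{rc}(\hat w):=(r_2-r_1,\,r_3-r_2,\dots,\,r_{\ell+1}-r_\ell)$,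 a composition of $n$. *)

(* Defs.v *)
From mathcomp Require Import all_boot all_fingroup.

Set Implicit Arguments.
Unset Strict Implicit.
Unset Printing Implicit Defensive.

(* Positions, values and the parts of a composition are numbered from 0: a
   permutation a_1 ... a_m of {1, ..., m} has a_(i+1) - 1 at index i. Only
   comparisons of values and differences of positions are used below, so the
   shift is harmless; odd positions become even indices, and the partial sum
   s_(j+1) is [partial_sum alpha j]. *)

Definition one_line (m : nat) (w : 'S_m) : seq nat :=
  [seq val (w i) | i <- enum 'I_m].

Definition alternating_word (a : seq nat) : bool :=
  all (fun i => if odd i then nth 0 a i < nth 0 a i.+1
                else nth 0 a i > nth 0 a i.+1)
      (iota 0 (size a).-1).

Definition alternating (m : nat) (w : 'S_m) : bool :=
  alternating_word (one_line w).

Definition Euler (k : nat) : nat := #|[set w : 'S_k | alternating w]|.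

Definition hat_word (n : nat) (a : seq nat) : seq nat :=
  mkseq (fun i => nth 0 a (2 * i)) n.

Definition hat (n : nat) (w : 'S_(2 * n)) : seq nat := hat_word n (one_line w).

Definition record_position (b : seq nat) (i : nat) : bool :=
  all (fun j => nth 0 b j < nth 0 b i) (iota 0 i).

Definition record_positions (b : seq nat) : seq nat :=
  [seq i <- iota 0 (size b) | record_position b i].

(* The appended size b is the conventional last position r_(l+1), which is
   n + 1 when positions are numbered from 1. *)
Definition record_composition (b : seq nat) : seq nat :=
  let r := record_positions b in
  let r' := rcons r (size b) in
  mkseq (fun k => nth 0 r' k.+1 - nth 0 r' k) (size r).

Definition composition (n : nat) (alpha : seq nat) : bool :=
  all (fun p => 0 < p) alpha && (sumn alpha == n).

Definition partial_sum (alpha : seq nat) (j : nat) : nat :=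
  sumn (take j.+1 alpha).

Definition num_alternating_rc (n : nat) (alpha : seq nat) : nat :=
  #|[set w : 'S_(2 * n) | alternating w & record_composition (hat w) == alpha]|.

(* Main.v *)
Require Import Defs.
From mathcomp Require Import all_boot all_fingroup zify.

Set Implicit Arguments.
Unset Strict Implicit.
Unset Printing Implicit Defensive.

(** Let alpha = (beta, a), let p be the sum of beta and n = p + a. The largest
value of an alternating word of even length is a peak, so it is also the
largest entry of the peak word, hence its last record. Write the word as
u ++ m :: v with m the largest value: the last part of the record composition
is half the length of m :: v, and the earlier parts form the record composition
of the peaks of u. Thus |u| = 2p and |v| = 2a - 1. The word is alternating
exactly when u is alternating and v is alternating with the opposite first
step, because both steps next to m hold automatically
([alternating_rc_max], [alternating_rc_max_index]).

The conditions on u and on v only depend on the relative order of their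
letters, so the 2n - 1 letters other than m may be distributed in
'C(2n - 1, 2a - 1) ways, after which u and v are chosen independently
([count_take_drop]). Complementing values shows that there are Euler (2a - 1)
choices for v ([count_zigzag_true]). Therefore
  N(beta, a) = N(beta) * 'C(2n - 1, 2a - 1) * Euler (2a - 1),
which is [num_alternating_rc_rcons]; the product formula follows by adding the
parts of alpha one by one.

Permutations are handled as words: one-line notation identifies 'S_m with the
rearrangements of iota 0 m ([card_one_line]), which allows words to be cut and
relabelled freely. *)

(** * Counting words by a prefix condition and a suffix condition *)

Lemma count_sum (T : Type) (P : pred T) (s : seq T) :
  count P s = \sum_(w <- s) (P w : nat).
Proof. by rewrite -sum1_count big_mkcond; apply: eq_bigr => w _; case: (P w). Qed.

Lemma count_allpairs_cat (T : Type) (P Q : pred (seq T)) k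
    (us vs : seq (seq T)) :
  all (fun u => size u == k) us ->
  count (fun w => P (take k w) && Q (drop k w)) [seq u ++ v | u <- us, v <- vs]
  = count P us * count Q vs.
Proof.
elim: us => //= u us IH /andP[/eqP szu /IH {}IH].
rewrite count_cat IH mulnDl; congr (_ + _).
rewrite count_map.
rewrite (eq_count (a2 := fun v => P u && Q v)); last first.
  by move=> v /=; rewrite take_size_cat // drop_size_cat.
case: (P u) => /=; first by rewrite mul1n; apply: eq_count.
by rewrite mul0n; apply/eqP; rewrite -leqn0 leqNgt -has_count has_pred0.
Qed.

(** The orbit relation of the group that permutes the first [k] places of a
word among themselves, and likewise the remaining places. *)
Definition same_blocks (T : eqType) k (w' w : seq T) :=
  perm_eq (take k w') (take k w) && perm_eq (drop k w') (drop k w).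

Lemma same_blocks_permutations (T : eqType) (s w : seq T) k :
  k <= size s -> w \in permutations s ->
  perm_eq [seq w' <- permutations s | same_blocks k w' w]
    [seq u ++ v | u <- permutations (take k w), v <- permutations (drop k w)].
Proof.
move=> le_k; rewrite mem_permutations => ws.
have szw : size (take k w) = k by rewrite size_takel // (perm_size ws).
apply: uniq_perm.
- by rewrite filter_uniq ?permutations_uniq.
- apply: allpairs_uniq; rewrite ?permutations_uniq // => -[u v] [u' v'].
  move=> /allpairsP[[x y] /= []]; rewrite mem_permutations => /perm_size xs _ [-> _].
  move=> /allpairsP[[x' y'] /= []]; rewrite mem_permutations => /perm_size xs' _ [-> _].
  move=> /= /eqP; rewrite eqseq_cat; last by rewrite xs xs'.
  by case/andP=> /eqP-> /eqP->.
- move=> x; rewrite mem_filter mem_permutations.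
  apply/andP/allpairsP => [[/andP[ht hd] xs]|[[u v] /= []]].
    exists (take k x, drop k x).
    by rewrite /= !mem_permutations cat_take_drop; split.
  rewrite !mem_permutations => hu hv ->.
  have szu : size u = k by rewrite (perm_size hu).
  split; first by rewrite /same_blocks take_size_cat // drop_size_cat // hu.
  by apply: perm_trans ws; rewrite -[w in perm_eq _ w](cat_take_drop k) perm_cat.
Qed.

(** Double counting of the pairs (w, w') with the same blocks and w' satisfying
both conditions. For fixed w there are p * q such w', whatever w is; for fixed
w' there are k! (n - k)! such w. Hence n! p q = k! (n - k)! N, without ever
choosing the set of letters of the prefix explicitly. *)
Lemma count_take_drop (T : eqType) (s : seq T) k (P Q : pred (seq T)) p q :
  uniq s -> k <= size s ->
  (forall u, uniq u -> size u = k -> {subset u <= s} ->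
     count P (permutations u) = p) ->
  (forall v, uniq v -> size v = size s - k -> {subset v <= s} ->
     count Q (permutations v) = q) ->
  count (fun w => P (take k w) && Q (drop k w)) (permutations s)
  = 'C(size s, k) * (p * q).
Proof.
move=> us le_k hP hQ; set F := fun w => _.
have block w : w \in permutations s ->
  [/\ uniq (take k w), size (take k w) = k, uniq (drop k w),
      size (drop k w) = size s - k & {subset w <= s}].
  rewrite mem_permutations => ws.
  have uw : uniq w by rewrite (perm_uniq ws).
  rewrite take_uniq // drop_uniq // size_drop size_takel (perm_size ws) //.
  by split=> // x; rewrite (perm_mem ws).
have all_size w : w \in permutations s ->
  all (fun u => size u == k) (permutations (take k w)).
  case/block=> _ sz _ _ _; apply/allP=> u.
  by rewrite mem_permutations => /perm_size->; apply/eqP.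
have fibre w : w \in permutations s ->
  \sum_(w' <- permutations s) (same_blocks k w' w && F w' : nat) = p * q.
  move=> hw; have [ut st ud sd sub] := block w hw.
  rewrite -count_sum (eq_count (a2 := predI F (same_blocks k ^~ w))); last first.
    by move=> x /=; rewrite andbC.
  rewrite -count_filter (seq.permP (same_blocks_permutations le_k hw)).
  rewrite count_allpairs_cat; last exact: all_size.
  by rewrite hP ?hQ // => x; [move/mem_drop/sub | move/mem_take/sub].
have cofibre w : w \in permutations s ->
  \sum_(w' <- permutations s) (same_blocks k w w' && F w : nat)
  = k`! * (size s - k)`! * F w.
  move=> hw; have [ut st ud sd _] := block w hw.
  under eq_bigr => w' _ do rewrite -mulnb.
  rewrite -big_distrl /= -count_sum; congr (_ * _).
  rewrite (eq_count (a2 := same_blocks k ^~ w)); last first.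
    by move=> x; rewrite /= /same_blocks perm_sym (perm_sym (drop k x)).
  rewrite -size_filter (perm_size (same_blocks_permutations le_k hw)).
  by rewrite size_allpairs !size_permutations // st sd.
apply/eqP; rewrite -(eqn_pmul2l (m := k`! * (size s - k)`!)); last first.
  by rewrite muln_gt0 !fact_gt0.
rewrite mulnA [_ * 'C(_, _)]mulnC bin_fact // count_sum big_distrr /=.
under eq_big_seq => w hw do rewrite -cofibre //.
rewrite exchange_big /= (eq_big_seq _ fibre) big_const_seq count_predT.
by rewrite iter_addn_0 size_permutations // mulnC.
Qed.

(** Since [F] pins [m] to place [k], deleting [m] is inverse to inserting it
there. *)
Lemma count_max_at (s : seq nat) m k (F : pred (seq nat)) :
  uniq (m :: s) -> k <= size s ->
  (forall w, perm_eq w (m :: s) -> F w -> nth 0 w k = m) ->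
  count F (permutations (m :: s))
  = count (fun w => F (take k w ++ m :: drop k w)) (permutations s).
Proof.
move=> ums le_k hF; pose ins w := take k w ++ m :: drop k w.
have /andP[ms us] := ums.
have insP w : perm_eq (ins w) (m :: w).
  by rewrite /ins perm_catC cat_cons perm_cons perm_catC cat_take_drop.
rewrite -size_filter -[in RHS](count_map ins F) -[in RHS]size_filter.
apply/perm_size/uniq_perm; rewrite ?filter_uniq ?permutations_uniq //.
  rewrite map_inj_in_uniq ?permutations_uniq // => x y.
  rewrite !mem_permutations => /perm_size xs /perm_size ys /eqP.
  rewrite eqseq_cat ?size_takel ?xs ?ys // eqseq_cons eqxx /=.
  by rewrite -eqseq_cat ?size_takel ?xs ?ys // !cat_take_drop => /eqP.
move=> w; rewrite !mem_filter mem_permutations; case Fw: (F w) => //=.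
apply/idP/mapP => [ws|[y]]; last first.
  rewrite mem_permutations => ys ->.
  by apply: perm_trans (insP y) _; rewrite perm_cons.
have szw := perm_size ws.
have wk := hF _ ws Fw.
have lek : k < size w by rewrite szw.
have Dw : w = ins (take k w ++ drop k.+1 w).
  have szt : size (take k w) = k by rewrite size_takel // ltnW.
  rewrite /ins take_size_cat // drop_size_cat //.
  by rewrite -[m]wk -drop_nth // cat_take_drop.
exists (take k w ++ drop k.+1 w) => //; rewrite mem_permutations.
by rewrite -(perm_cons m); apply: perm_trans ws; rewrite perm_sym {1}Dw.
Qed.

(** * Conditions that only depend on the relative order of the letters *)

Definition order_invariant (P : pred (seq nat)) :=
  forall (f : nat -> nat) (w : seq nat),
    {in w &, {mono f : x y / x < y}} -> P (map f w) = P w.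

Lemma perm_map_permutations (f : nat -> nat) (s : seq nat) :
  {in s &, injective f} -> uniq s ->
  perm_eq (map (map f) (permutations s)) (permutations (map f s)).
Proof.
move=> injf us.
have ufs : uniq (map f s) by rewrite map_inj_in_uniq.
have uL : uniq (map (map f) (permutations s)).
  rewrite map_inj_in_uniq ?permutations_uniq // => x y.
  rewrite !mem_permutations => xs ys; apply: inj_in_map.
    exact: injf.
  - by apply/allP=> z; rewrite (perm_mem xs).
  - by apply/allP=> z; rewrite (perm_mem ys).
have sub : {subset map (map f) (permutations s) <= permutations (map f s)}.
  move=> x /mapP[y]; rewrite !mem_permutations => ys ->; exact: perm_map.
apply: uniq_perm => //; first exact: permutations_uniq.
apply: (uniq_min_size uL sub _).2.
by rewrite size_map !size_permutations // size_map.
Qed.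

(** The set [s] is the image of an initial segment of the naturals under the
increasing enumeration of [s], and rearrangements are carried along. *)
Lemma count_order_invariant (P : pred (seq nat)) (s : seq nat) :
  order_invariant P -> uniq s ->
  count P (permutations s) = count P (permutations (iota 0 (size s))).
Proof.
move=> invP us; set t := sort leq s.
have ut : uniq t by rewrite sort_uniq.
have szt : size t = size s by rewrite size_sort.
have lt_t : sorted ltn t by rewrite ltn_sorted_uniq_leq ut sort_sorted //; apply: leq_total.
have mono : {in iota 0 (size s) &, {mono nth 0 t : x y / x < y}}.
  move=> i j; rewrite !mem_iota /= !add0n -szt => hi hj.
  apply: (leqW_mono_in (D := [pred x | x < size t])) => //.
  apply: leq_mono_in => x y hx hy.
  exact: (sorted_ltn_nth ltn_trans 0 lt_t).
have st : perm_eq s (map (nth 0 t) (iota 0 (size s))).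
  by rewrite -szt -/(mkseq _ _) mkseq_nth perm_sym perm_sort.
rewrite (seq.permP (perm_permutations st)).
rewrite -(seq.permP (perm_map_permutations _ (iota_uniq _ _))); last first.
  move=> i j; rewrite !mem_iota /= !add0n -szt => hi hj /eqP.
  by rewrite nth_uniq // => /eqP.
rewrite count_map; apply: eq_in_count => w /=.
rewrite mem_permutations => /perm_mem hw; apply: invP => i j.
by rewrite !hw; apply: mono.
Qed.

(** * Alternating words *)

(** The flag [b] tells whether the first step goes up. Removing the largest
letter of an alternating word leaves a suffix that starts by going up, so both
kinds are needed. *)
Definition zigzag (b : bool) (a : seq nat) : bool :=
  all (fun i => if b (+) odd i then nth 0 a i < nth 0 a i.+1
                else nth 0 a i > nth 0 a i.+1)
      (iota 0 (size a).-1).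

Lemma zigzagP b a :
  reflect (forall i, i.+1 < size a ->
             if b (+) odd i then nth 0 a i < nth 0 a i.+1
             else nth 0 a i > nth 0 a i.+1)
          (zigzag b a).
Proof.
apply: (iffP allP) => h i hi; apply: h; move: hi; rewrite mem_iota /=;
  case: (size a) => //= *; lia.
Qed.

Lemma alternating_wordE a : alternating_word a = zigzag false a.
Proof. by []. Qed.

(** The flag [c] tells whether [f] reverses the order; one statement covers
relabelling and complementation. *)
Lemma zigzag_map b c (f : nat -> nat) w :
  {in w &, forall x y, (f x < f y) = if c then y < x else x < y} ->
  zigzag b (map f w) = zigzag (b (+) c) w.
Proof.
move=> hf; rewrite /zigzag size_map; apply: eq_in_all => i.
rewrite mem_iota /= add0n => hi.
have [hi0 hi1] : i < size w /\ i.+1 < size w by move: hi; case: (size w) => //= *; lia.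
rewrite !(nth_map 0) // !hf ?mem_nth //.
by case: b; case: c {hf}; case: (odd i).
Qed.

Lemma zigzag_order_invariant b : order_invariant (zigzag b).
Proof. by move=> f w hf; rewrite (@zigzag_map b false) ?addbF // => x y; apply: hf. Qed.

(** After a prefix of even length the step into [m] must go up and the step out
of it must go down, which holds since [m] exceeds all other letters. *)
Lemma alternating_word_max u m v :
  ~~ odd (size u) -> all (gtn m) (u ++ v) ->
  alternating_word (u ++ m :: v) = alternating_word u && zigzag true v.
Proof.
rewrite all_cat => ou /andP[/(all_nthP 0) um /(all_nthP 0) vm].
have nthl i : i < size u -> nth 0 (u ++ m :: v) i = nth 0 u i.
  by move=> hi; rewrite nth_cat hi.
have nthm : nth 0 (u ++ m :: v) (size u) = m.
  by rewrite nth_cat ltnn subnn.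
have nthr i : nth 0 (u ++ m :: v) (size u + i.+1) = nth 0 v i.
  by rewrite nth_cat ltnNge leq_addr addKn.
rewrite !alternating_wordE.
apply/zigzagP/andP => [h|[/zigzagP hu /zigzagP hv] i].
  split; apply/zigzagP => i hi.
    have := h i; rewrite !nthl ?(ltnW hi) //; apply.
    by rewrite size_cat ltn_addr.
  have := h (size u + i.+1); rewrite -addnS !nthr size_cat /= ltn_add2l ltnS.
  by rewrite oddD (negbTE ou) /=; apply.
rewrite size_cat /= => hi.
have [lt_i|le_i] := ltnP i.+1 (size u).
  by rewrite !nthl ?(ltnW lt_i) //; apply: hu.
have [lt_i|{}le_i] := ltnP i (size u).
  (* The step into m. *)
  have Di : size u = i.+1 by lia.
  rewrite nthl // -Di nthm; move: ou; rewrite Di /= negbK => -> /=.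
  exact: um.
case: (ltngtP (size u) i) hi le_i => // [lt_i|<-] hi _; last first.
  (* The step out of m. *)
  rewrite (negbTE ou) /= -(addn1 (size u)) nthr nthm; apply: vm; lia.
have -> : i = size u + (i - size u).-1.+1 by lia.
rewrite -[(_ + _).+1]addnS !nthr oddD (negbTE ou) /=.
apply: (hv (i - size u).-1); lia.
Qed.

(** At an odd index [m] would be a valley, below the letter before it. *)
Lemma alternating_word_max_even u m v :
  all (gtn m) u -> alternating_word (u ++ m :: v) -> ~~ odd (size u).
Proof.
rewrite alternating_wordE => /(all_nthP 0) um /zigzagP h; apply/negP => ou.
case Du: (size u) ou => [//|k] /= ok.
have /h : k.+1 < size (u ++ m :: v) by rewrite size_cat Du /=; lia.
rewrite /= (negbTE ok) !nth_cat Du ltnn subnn ltnSn /=.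
have := um k; rewrite Du ltnSn => /(_ isT) /=; lia.
Qed.

(** * Records of the peak word *)

Lemma record_positions_max b1 m b2 :
  all (gtn m) b1 -> all (gtn m) b2 ->
  record_positions (b1 ++ m :: b2) = rcons (record_positions b1) (size b1).
Proof.
move=> /(all_nthP 0) h1 /(all_nthP 0) h2.
rewrite /record_positions size_cat /= iotaD filter_cat add0n /= -cats1.
have rec_m : record_position (b1 ++ m :: b2) (size b1).
  apply/allP => j; rewrite mem_iota /= add0n => hj.
  by rewrite !nth_cat hj ltnn subnn /=; apply: h1.
rewrite rec_m; congr (_ ++ _).
  apply: eq_in_filter => i; rewrite mem_iota /= add0n => hi.
  apply: eq_in_all => j; rewrite mem_iota /= add0n => hj.
  by rewrite !nth_cat hi (ltn_trans hj hi).
congr (_ :: _); apply/eqP; rewrite -[_ == _]negbK -has_filter -all_predC.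
apply/allP => i; rewrite mem_iota => /andP[hi hi'] /=.
apply/negP => /allP /(_ (size b1)); rewrite mem_iota /= add0n hi => /(_ isT).
rewrite !nth_cat ltnn subnn /= [i < size b1]ltnNge (ltnW hi) /=.
have -> : i - size b1 = (i - (size b1).+1).+1 by lia.
rewrite /= ltnNge => /negP[]; apply/ltnW/h2; lia.
Qed.

(** The conventional last position of [b1], namely its size, is where the
record [m] sits, so the parts coming from [b1] do not change. *)
Lemma record_composition_max b1 m b2 :
  all (gtn m) b1 -> all (gtn m) b2 ->
  record_composition (b1 ++ m :: b2)
  = rcons (record_composition b1) (size b2).+1.
Proof.
move=> h1 h2; rewrite /record_composition record_positions_max //.
set r := record_positions b1; rewrite size_rcons /mkseq -addn1 iotaD map_cat.
rewrite add0n cats1 /=; congr rcons; last first.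
  rewrite !nth_rcons !size_rcons !ltnn !ltnSn !eqxx size_cat /=; lia.
apply/eq_in_map => i; rewrite mem_iota /= add0n => hi.
rewrite !(nth_rcons 0 (rcons r _)) !size_rcons !ltnS hi (ltnW hi) //.
Qed.

Lemma hat_word_max p q u m v :
  size u = 2 * p ->
  hat_word (p + q.+1) (u ++ m :: v)
  = hat_word p u ++ m :: mkseq (fun i => nth 0 v (2 * i).+1) q.
Proof.
move=> su; rewrite /hat_word /mkseq iotaD map_cat add0n /=; congr (_ ++ _ :: _).
- apply/eq_in_map => i; rewrite mem_iota /= add0n => hi.
  by rewrite nth_cat su ltn_mul2l hi.
- by rewrite nth_cat su ltnn subnn.
- rewrite -(addn0 p.+1) iotaDl -map_comp; apply/eq_in_map => i /=.
  rewrite mem_iota => hi; rewrite nth_cat su ifF; last lia.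
  by have -> : 2 * (p.+1 + i) - 2 * p = (2 * i).+2 by lia.
Qed.

(** * One-line notation *)

Lemma perm_one_lines m :
  perm_eq [seq one_line w | w <- enum 'S_m] (permutations (iota 0 m)).
Proof.
have inj : injective (@one_line m).
  move=> v w /eq_in_map h; apply/permP => i; apply: val_inj.
  by apply: h; rewrite mem_enum.
have uL : uniq [seq one_line w | w <- enum 'S_m].
  by rewrite map_inj_uniq // enum_uniq.
apply: uniq_perm => //; first exact: permutations_uniq.
have sub : {subset [seq one_line w | w <- enum 'S_m] <= permutations (iota 0 m)}.
  move=> _ /mapP[w _ ->]; rewrite mem_permutations -val_enum_ord /one_line.
  rewrite (map_comp val w) perm_map // uniq_perm ?enum_uniq //.
    by rewrite map_inj_uniq ?enum_uniq //; apply: perm_inj.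
  move=> i; rewrite mem_enum; apply/mapP; exists (w^-1%g i); first exact: mem_enum.
  by rewrite permKV.
apply: (uniq_min_size uL sub _).2.
by rewrite size_map size_permutations ?iota_uniq // size_iota -cardE card_Sn.
Qed.

Lemma card_one_line m (P : pred (seq nat)) :
  #|[set w : 'S_m | P (one_line w)]| = count P (permutations (iota 0 m)).
Proof.
rewrite -(seq.permP (perm_one_lines m)) count_map cardsE cardE -size_filter.
by rewrite /enum_mem -filter_predI; congr size; apply: eq_filter => w /=; rewrite andbT.
Qed.

(** The complement x |-> k - x exchanges up and down. It maps the letters below k
to 1, ..., k rather than to themselves, which relative order does not see. *)
Lemma count_zigzag_true k :
  count (zigzag true) (permutations (iota 0 k)) = Euler k.
Proof.
rewrite /Euler /alternating card_one_line.
pose f x := k - x.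
have inj : {in iota 0 k &, injective f}.
  move=> x y; rewrite !mem_iota /f /=; lia.
have := count_order_invariant (@zigzag_order_invariant true)
  (s := map f (iota 0 k)).
rewrite map_inj_in_uniq // iota_uniq size_map size_iota => /(_ isT) <-.
rewrite -(seq.permP (perm_map_permutations inj (iota_uniq _ _))) count_map.
apply: eq_in_count => w; rewrite mem_permutations => /perm_mem wk /=.
rewrite (@zigzag_map true true) // => x y; rewrite !wk !mem_iota /f /=; lia.
Qed.

(** * Removing the largest letter *)

(** The number of peaks is read off from the length of the word: with a
prescribed number of peaks, peaks beyond the end of the word would take the
default value 0 and the condition would not be invariant under relabelling. *)
Definition alternating_rc (alpha w : seq nat) : bool :=
  alternating_word w && (record_composition (hat_word (size w)./2 w) == alpha).

Lemma num_alternating_rcE n alpha :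
  num_alternating_rc n alpha
  = count (alternating_rc alpha) (permutations (iota 0 (2 * n))).
Proof.
rewrite -card_one_line; apply: eq_card => w; rewrite !inE /alternating_rc.
have -> : (size (one_line w))./2 = n by rewrite size_map size_enum_ord; lia.
by [].
Qed.

Lemma record_composition_map (f : nat -> nat) b :
  {in b &, {mono f : x y / x < y}} ->
  record_composition (map f b) = record_composition b.
Proof.
move=> hf; rewrite /record_composition size_map.
suff -> : record_positions (map f b) = record_positions b by [].
rewrite /record_positions size_map; apply: eq_in_filter => i.
rewrite mem_iota /= add0n => hi; apply: eq_in_all => j.
rewrite mem_iota /= add0n => hj; have lt_j := ltn_trans hj hi.
by rewrite !(nth_map 0) // hf ?mem_nth.
Qed.

Lemma alternating_rc_order_invariant alpha : order_invariant (alternating_rc alpha).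
Proof.
move=> f w hf; rewrite /alternating_rc !alternating_wordE zigzag_order_invariant //.
congr (_ && (_ == _)); rewrite size_map.
have lt_w i : i < (size w)./2 -> 2 * i < size w by lia.
have -> : hat_word (size w)./2 (map f w) = map f (hat_word (size w)./2 w).
  rewrite /hat_word /mkseq -map_comp; apply/eq_in_map => i.
  by rewrite mem_iota /= add0n => /lt_w hi; rewrite (nth_map 0).
apply: record_composition_map => x y /mapP[i hi ->] /mapP[j hj ->].
apply: hf; apply: mem_nth; apply: lt_w.
  by move: hi; rewrite mem_iota.
by move: hj; rewrite mem_iota.
Qed.

Lemma hat_word_all p m u :
  size u = 2 * p -> all (gtn m) u -> all (gtn m) (hat_word p u).
Proof.
move=> su /allP h; apply/allP => x /mapP[i]; rewrite mem_iota /= add0n => hi ->.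
by apply/h/mem_nth; rewrite su ltn_mul2l.
Qed.

Lemma record_composition_hat_max p q u m v :
  size u = 2 * p -> size v = (2 * q).+1 -> all (gtn m) (u ++ v) ->
  record_composition (hat_word (p + q.+1) (u ++ m :: v))
  = rcons (record_composition (hat_word p u)) q.+1.
Proof.
move=> su sv; rewrite all_cat => /andP[um vm].
rewrite hat_word_max // record_composition_max ?size_mkseq //.
  exact: hat_word_all.
apply/allP => x /mapP[i]; rewrite mem_iota /= add0n => hi ->.
by apply: (allP vm); apply: mem_nth; rewrite sv ltnS ltn_mul2l.
Qed.

Lemma alternating_rc_max p q beta u m v :
  size u = 2 * p -> size v = (2 * q).+1 -> all (gtn m) (u ++ v) ->
  alternating_rc (rcons beta q.+1) (u ++ m :: v)
  = alternating_rc beta u && zigzag true v.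
Proof.
move=> su sv ltm; rewrite /alternating_rc alternating_word_max //; last first.
  by rewrite su oddM.
have -> : (size (u ++ m :: v))./2 = p + q.+1 by rewrite size_cat /=; lia.
have -> : (size u)./2 = p by lia.
by rewrite record_composition_hat_max // eqseq_rcons eqxx andbT andbAC.
Qed.

(** The largest letter is the last record among the peaks, so the last part of
the record composition determines its place. *)
Lemma alternating_rc_max_index p q beta m (w : seq nat) :
  perm_eq w (m :: iota 0 m) -> m = 2 * p + (2 * q).+1 ->
  alternating_rc (rcons beta q.+1) w -> nth 0 w (2 * p) = m.
Proof.
move=> wm Dm; have mw : m \in w by rewrite (perm_mem wm) mem_head.
have szw := perm_size wm; rewrite /= size_iota in szw.
have [u [v Dw]] : exists u v : seq nat, w = u ++ m :: v.
  by case/splitPr: mw => u v; exists u, v.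
rewrite {w mw}Dw in wm szw *.
have ltm : all (gtn m) (u ++ v).
  move: wm; rewrite perm_catC cat_cons perm_cons perm_catC => /perm_mem h.
  by apply/allP => x; rewrite h mem_iota.
have /andP[um vm] : all (gtn m) u && all (gtn m) v by rewrite -all_cat.
case/andP => alt; have ou := alternating_word_max_even um alt.
rewrite size_cat /= in szw.
pose p' := (size u)./2; pose q' := (size v)./2.
have su : size u = 2 * p' by rewrite /p'; lia.
have sv : size v = (2 * q').+1 by rewrite /q'; lia.
have -> : (size (u ++ m :: v))./2 = p' + q'.+1 by rewrite size_cat /=; lia.
rewrite record_composition_hat_max // eqseq_rcons => /andP[_ /eqP[Dq]].
have -> : 2 * p = size u by lia.
by rewrite nth_cat ltnn subnn.
Qed.

(** * The recurrence and the product formula *)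

Lemma num_alternating_rc_rcons p q beta :
  num_alternating_rc (p + q.+1) (rcons beta q.+1)
  = num_alternating_rc p beta
    * ('C(2 * (p + q.+1) - 1, 2 * q.+1 - 1) * Euler (2 * q.+1 - 1)).
Proof.
rewrite !num_alternating_rcE; set m := 2 * (p + q.+1) - 1.
have Dm : m = 2 * p + (2 * q).+1 by rewrite /m; lia.
have -> : 2 * q.+1 - 1 = (2 * q).+1 by lia.
have top : perm_eq (iota 0 (2 * (p + q.+1))) (m :: iota 0 m).
  have -> : 2 * (p + q.+1) = m + 1 by rewrite /m; lia.
  by rewrite iotaD perm_catC.
have um : uniq (m :: iota 0 m) by rewrite -(perm_uniq top) iota_uniq.
rewrite (seq.permP (perm_permutations top)).
rewrite (@count_max_at _ _ (2 * p)) ?size_iota //; last 2 first.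
- by rewrite Dm leq_addr.
- by move=> w wm; apply: alternating_rc_max_index.
rewrite (eq_in_count (a2 := fun w =>
  alternating_rc beta (take (2 * p) w) && zigzag true (drop (2 * p) w))); last first.
  move=> w; rewrite mem_permutations => wm.
  have szw := perm_size wm; rewrite size_iota in szw.
  apply: alternating_rc_max.
  - by rewrite size_takel // szw Dm leq_addr.
  - by rewrite size_drop szw Dm addKn.
  - by rewrite cat_take_drop; apply/allP => x; rewrite (perm_mem wm) mem_iota.
rewrite (@count_take_drop _ _ (2 * p) _ _
  (count (alternating_rc beta) (permutations (iota 0 (2 * p)))) (Euler (2 * q).+1));
  rewrite ?size_iota ?iota_uniq // ?Dm ?leq_addr //.
(* The lemma chooses the 2p letters of the prefix, the claim those of the
   suffix. *)
- by rewrite mulnCA -bin_sub ?leq_addr // addKn.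
- move=> u uu su _.
  by rewrite (count_order_invariant (@alternating_rc_order_invariant beta) uu) su.
- move=> v uv sv _; rewrite addKn in sv.
  by rewrite (count_order_invariant (@zigzag_order_invariant true) uv) sv count_zigzag_true.
Qed.

Theorem theorem1p1 (n : nat) (alpha : seq nat) (hn : 1 <= n)
    (halpha : composition n alpha) :
  num_alternating_rc n alpha =
  \prod_(j < size alpha)
    ('C(2 * partial_sum alpha j - 1, 2 * nth 0 alpha j - 1)
     * Euler (2 * nth 0 alpha j - 1)).
Proof.
move: halpha {hn} => /andP[+ /eqP <-]; elim/last_ind: alpha {n} => [_|beta a IH].
  by rewrite big_ord0 num_alternating_rcE.
rewrite all_rcons => /andP[]; case: a => // q _ /IH {}IH.
rewrite sumn_rcons num_alternating_rc_rcons IH size_rcons big_ord_recr /=.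
congr (_ * ('C(2 * _ - 1, 2 * _ - 1) * Euler (2 * _ - 1))).
- apply: eq_bigr => j _; rewrite /partial_sum -cats1 takel_cat // nth_cat.
  by rewrite ltn_ord.
- by rewrite /partial_sum take_oversize ?size_rcons // sumn_rcons.
- by rewrite nth_rcons ltnn eqxx.
- by rewrite nth_rcons ltnn eqxx.
Qed.
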